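(* Let $(G,*,\mathbf e)$ be a hyper group and let $\sim$ be the equivalence relation on $G$: $x\sim y$ iff there exist $e_\alpha,e_\beta\in\mathbf e$ with $x*e_\alpha=y*e_\beta$; write $\bar x$ for the class of $x$. Assume that $\sim$ is consistent with $*$. Then the operation $\bar x*\bar y:=\overline{x*y}$ on $\bar G=\{\bar x: x\in G\}$ is well defined, and $(\bar G,* )$ is a group.
   Context: Hyper group: Let $(G,* )$ be a semigroup. A subset $\mathbf e\subset G$ is an identity set if (i) $g*e=e*g$ for all $g\in G$, $e\in\mathbf e$; (ii) $\mathbf e=\{e_\lambda:\lambda\in\Lambda\}$ is indexed without repetition by a lattice $(\Lambda,\le)$ and $e_\lambda*e_\mu=e_{\lambda\vee\mu}$; (iii) for each $g\in G$ there is a unique $e_g=e_{\lambda_g}\in\mathbf e$ such that for all $\lambda\in\Lambda$: $e_\lambda*g=g$ if and only if $\lambda\le\lambda_g$. A hyper group $(G,*,\mathbf e)$ is a semigroup with an identity set such that for each $g\in G$ there is $g^{-1}\in G$ with $g*g^{-1}=g^{-1}*g=e_g$. The equivalence $\sim$ is consistent with $*$ if (a) $x_1\sim x_2$ and $y_1\sim y_2$ imply $x_1*y_1\sim x_2*y_2$; and (b) if $x\sim e$ for some $e\in\mathbf e$, then $x\in\mathbf e$. *)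

(* Defs.v *)
From HB Require Import structures.
From mathcomp Require Import all_boot all_order all_classical.

Set Implicit Arguments.
Unset Strict Implicit.
Unset Printing Implicit Defensive.

Import Order.TTheory.
Local Open Scope classical_set_scope.

Section HyperGroup.
Context {G : semigroupType} {d : Order.disp_t} {L : latticeType d}.
(* The identity set is [range e], for an injective family e indexed by L. *)
Variable e : L -> G.

(* [local_identity g a] says that a = e_g. *)
Definition local_identity (g a : G) : Prop :=
  exists2 l : L, a = e l & forall m : L, (e m * g)%g = g <-> (m <= l)%O.

Record identity_set : Prop := IdentitySet {
  identity_comm : forall (g : G) (l : L), (g * e l = e l * g)%g;
  identity_inj : injective e;
  identity_join : forall l m : L, (e l * e m)%g = e (l `|` m)%O;
  identity_local : forall g : G, exists! a : G, local_identity g a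
}.

Record hyper_group : Prop := HyperGroup {
  (* A semigroupType may have an empty carrier. *)
  hyper_group_nonempty : inhabited G;
  hyper_group_identity : identity_set;
  hyper_group_inv : forall g : G, exists h a : G,
    [/\ local_identity g a, (g * h)%g = a & (h * g)%g = a]
}.

Definition hsim (x y : G) : Prop :=
  exists a b : L, (x * e a)%g = (y * e b)%g.

Record consistent : Prop := Consistent {
  consistent_mul : forall x1 x2 y1 y2 : G,
    hsim x1 x2 -> hsim y1 y2 -> hsim (x1 * y1)%g (x2 * y2)%g;
  consistent_identity : forall (x : G) (l : L), hsim x (e l) -> range e x
}.

Definition hclass (x : G) : set G := [set y | hsim x y].

Definition hquot : Type := set_type (range hclass).

Definition hbar (x : G) : hquot :=
  exist _ (hclass x) (mem_set (imageT hclass x)).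

Lemma hsim_refl : hyper_group -> forall x, hsim x x.
Proof.
move=> hG x; have [_ [_ [[l _ _] _ _]]] := hyper_group_inv hG x.
by exists l, l.
Qed.

Lemma hsim_sym x y : hsim x y -> hsim y x.
Proof. by move=> [a [b xy]]; exists b, a. Qed.

Lemma hsim_trans : hyper_group -> forall x y z, hsim x y -> hsim y z -> hsim x z.
Proof.
move=> hG x y z [a [b xy]] [c [f yz]].
have [comm _ join _] := hyper_group_identity hG.
exists (a `|` c)%O, (f `|` b)%O.
by rewrite -!join !mulgA xy -yz -!mulgA (comm (e b)).
Qed.

Lemma hbarP : hyper_group -> forall x y, hbar x = hbar y <-> hsim x y.
Proof.
move=> hG x y; split=> [/(congr1 sval)/= xy|xy].
  by rewrite -[hsim x y]/(hclass x y) xy; apply: hsim_refl.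
apply: eq_exist; apply/seteqP; split=> z /=; apply: hsim_trans => //.
exact: hsim_sym.
Qed.

End HyperGroup.

(* Main.v *)
Require Import Defs.
From HB Require Import structures.
From mathcomp Require Import all_boot all_order all_classical.

(** Multiplying by an element of the identity set never changes the class of
    an element, because the identity set is central and closed under products
    ([hsim_identity_mul]).  So all [e l] lie in one class, and that class is
    neutral.  Since an inverse [h] of [g] makes both [g * h] and [h * g] some
    [e l], its class is a two-sided inverse of the class of [g].  Compatibility
    of the equivalence with products makes the multiplication of classes well
    defined, and associativity is inherited from [G].

    The operations on the quotient are computed on chosen representatives
    ([hrep]); the rule [hmul_hbar] removes the choice from products, and each group axiom
    then reduces to an equality of classes of elements of [G]. *)

Set Implicit Arguments.
Unset Strict Implicit.
Unset Printing Implicit Defensive.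

Section QuotientGroup.
Context {G : semigroupType} {d : Order.disp_t} {L : latticeType d}.
Variable e : L -> G.

Lemma hbar_surj (q : hquot e) : exists x, hbar e x = q.
Proof.
case: q => A hA; have [x _ xA] := set_mem hA.
by exists x; apply: eq_exist.
Qed.

Definition hrep (q : hquot e) : G := projT1 (cid (hbar_surj q)).

Lemma hrepK q : hbar e (hrep q) = q.
Proof. exact: projT2 (cid (hbar_surj q)). Qed.

Definition hmul (p q : hquot e) : hquot e := hbar e (hrep p * hrep q)%g.

Hypothesis hG : hyper_group e.

(** The witnesses are [l] and [l `|` l]: by centrality
    [(e l * x) * e l = x * (e l * e l)], and [e l * e l] is again in the
    identity set. *)
Lemma hsim_identity_mul (l : L) (x : G) : hsim e (e l * x)%g x.
Proof.
have [comm _ join _] := hyper_group_identity hG.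
by exists l, (Order.join l l); rewrite -comm -mulgA join.
Qed.

(** Both [e l] and [e m] become [e l * e m] after multiplication by a member
    of the identity set. *)
Lemma hbar_identity (l m : L) : hbar e (e l) = hbar e (e m).
Proof.
apply/hbarP => //; exists m, l.
by rewrite (identity_comm (hyper_group_identity hG)).
Qed.

Lemma hbar_identity_mul (l : L) (x : G) : hbar e (e l * x)%g = hbar e x.
Proof. by apply/hbarP => //; apply: hsim_identity_mul. Qed.

Lemma hbar_mul_identity (x : G) (l : L) : hbar e (x * e l)%g = hbar e x.
Proof.
by rewrite (identity_comm (hyper_group_identity hG)) hbar_identity_mul.
Qed.

Lemma hinv_exists (g : G) : exists h : G,
  exists2 l : L, (g * h)%g = e l & (h * g)%g = e l.
Proof.
by have [h [a [[l -> _] gh hg]]] := hyper_group_inv hG g; exists h, l.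
Qed.

(** The lattice [L] may be empty as a type, but a hyper group has an element,
    whose local identity supplies an index. *)
Lemma identity_index : inhabited L.
Proof.
have [g] := hyper_group_nonempty hG; have [h [l _ _]] := hinv_exists g.
exact: inhabits l.
Qed.

(** The choice of representative and of its inverse is harmless: the axioms
    only use that both products with the representative lie in the identity
    set. *)
Definition hinv (q : hquot e) : hquot e :=
  hbar e (projT1 (cid (hinv_exists (hrep q)))).

Hypothesis hC : consistent e.

Lemma hbar_mul (x1 x2 y1 y2 : G) :
  hbar e x1 = hbar e x2 -> hbar e y1 = hbar e y2 ->
  hbar e (x1 * y1)%g = hbar e (x2 * y2)%g.
Proof.
by move=> /(hbarP hG) x12 /(hbarP hG) y12; apply/hbarP/consistent_mul.
Qed.

Lemma hmul_hbar (x y : G) : hmul (hbar e x) (hbar e y) = hbar e (x * y)%g.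
Proof. by apply: hbar_mul; apply: hrepK. Qed.

Lemma hmulA : associative hmul.
Proof.
move=> p q r; rewrite -(hrepK p) -(hrepK q) -(hrepK r).
by rewrite !hmul_hbar mulgA.
Qed.

Lemma hmul1q (l : L) : left_id (hbar e (e l)) hmul.
Proof. by move=> q; rewrite -(hrepK q) hmul_hbar hbar_identity_mul. Qed.

Lemma hmulq1 (l : L) : right_id (hbar e (e l)) hmul.
Proof. by move=> q; rewrite -(hrepK q) hmul_hbar hbar_mul_identity. Qed.

Lemma hmulVq (l : L) : left_inverse (hbar e (e l)) hinv hmul.
Proof.
move=> q; rewrite -[X in hmul _ X]hrepK /hinv.
case: cid => h [m _ hq] /=.
by rewrite hmul_hbar hq; apply: hbar_identity.
Qed.

Lemma hmulqV (l : L) : right_inverse (hbar e (e l)) hinv hmul.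
Proof.
move=> q; rewrite -[X in hmul X _]hrepK /hinv.
case: cid => h [m qh _] /=.
by rewrite hmul_hbar qh; apply: hbar_identity.
Qed.

End QuotientGroup.

Theorem proposition3p15 (G : semigroupType) (d : Order.disp_t)
    (L : latticeType d) (e : L -> G) (hG : hyper_group e)
    (hC : consistent e) :
  (forall x1 x2 y1 y2 : G, hbar e x1 = hbar e x2 -> hbar e y1 = hbar e y2 ->
    hbar e (x1 * y1)%g = hbar e (x2 * y2)%g) /\
  (exists grp : Group.axioms_ (hquot e),
    let Q : groupType := Group.Pack grp in
    forall x y : G,
      ((hbar e x : Q) * (hbar e y : Q))%g = hbar e (x * y)%g).
Proof.
split; first exact: hbar_mul.
have [l] := identity_index hG.
pose grp := isGroup.Build (hquot e) (hmulA hG hC) (hmul1q hG hC l)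
  (hmulq1 hG hC l) (hmulVq hG hC l) (hmulqV hG hC l).
(* Spelling the quotient as a subtype gives it the choice structure inherited
   from sets of elements of [G]. *)
pose Q : groupType := HB.pack {A | A \in range (hclass e)} grp.
exists (Group.class Q) => /= x y.
exact: hmul_hbar.
Qed.
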